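(* Let $R=\{(1,0),(1,1),(2,0),(2,1),(2,2),(3,0),(3,1),(3,2)\}$ and let $\mathrm{P}_{13}=(123,R)$ and $\mathrm{P}_{14}=(132,R)$ be mesh patterns. For every $n\ge 1$ and all integers $k,\ell\ge 0$, $$|\{\sigma\in\mathfrak{S}_n: \mathrm{P}_{13}(\sigma)=k,\ \mathrm{P}_{14}(\sigma)=\ell\}| = |\{\sigma\in\mathfrak{S}_n: \mathrm{P}_{14}(\sigma)=k,\ \mathrm{P}_{13}(\sigma)=\ell\}|.$$
   Context: $\mathfrak{S}_n$ is the set of permutations $\sigma=\sigma_1\sigma_2\cdots\sigma_n$ of $[n]=\{1,\dots,n\}$ in one-line notation. A mesh pattern is a pair $p=(\pi,R)$ with $\pi\in\mathfrak{S}_m$ and $R\subseteq\{0,\dots,m\}\times\{0,\dots,m\}$ (the set of shaded unit cells, each given by its bottom-left corner, in the grid with dots at $(i,\pi_i)$). An occurrence of $p$ in $\sigma\in\mathfrak{S}_n$ is a choice of indices $i_1<\cdots<i_m$ such that $\sigma_{i_1}\cdots\sigma_{i_m}$ is order-isomorphic to $\pi$ and, for every $(a,b)\in R$, there is no index $r$ with $i_a<r<i_{a+1}$ and $v_b<\sigma_r<v_{b+1}$; here $v_1<\cdots<v_m$ is the increasing rearrangement of $\sigma_{i_1},\dots,\sigma_{i_m}$, $i_0=v_0=0$ and $i_{m+1}=v_{m+1}=n+1$. $p(\sigma)$ denotes the number of occurrences of $p$ in $\sigma$. *)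

(* Defs.v *)
From mathcomp Require Import all_boot all_fingroup.

Set Implicit Arguments.
Unset Strict Implicit.
Unset Printing Implicit Defensive.

(* Elements of 'S_n act on {0, ..., n-1}: the letter sigma_i of the one-line
   notation (1 <= i <= n) is (s (i-1)).+1. *)

Record mesh_pattern (m : nat) := MeshPattern {
  mesh_perm : 'S_m;
  mesh_cells : {set 'I_m.+1 * 'I_m.+1}
}.

Section Occurrences.

Variables (m n : nat) (p : mesh_pattern m) (s : 'S_n).

(* A choice of indices is an increasing f : 'I_m -> 'I_n, with
   i_a = (f (a-1)).+1 for 1 <= a <= m. *)
Implicit Type f : {ffun 'I_m -> 'I_n}.

Definition increasing f : bool :=
  [forall a : 'I_m, forall b : 'I_m, (a < b) ==> (f a < f b)].

Definition order_isomorphic f : bool :=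
  [forall a : 'I_m, forall b : 'I_m,
    (s (f a) < s (f b)) == (mesh_perm p a < mesh_perm p b)].

(* The sequences i_0, i_1, ..., i_(m+1) and v_0, v_1, ..., v_(m+1), with
   1-based indices and letters, i_0 = v_0 = 0 and i_(m+1) = v_(m+1) = n+1. *)
Definition grid_indices f : seq nat :=
  0 :: rcons [seq (f a).+1 | a <- enum 'I_m] n.+1.

Definition grid_values f : seq nat :=
  0 :: rcons (sort leq [seq (s (f a)).+1 | a <- enum 'I_m]) n.+1.

Definition in_cell f (a b : nat) (r : 'I_n) : bool :=
  [&& nth 0 (grid_indices f) a < r.+1,
      r.+1 < nth 0 (grid_indices f) a.+1,
      nth 0 (grid_values f) b < (s r).+1
    & (s r).+1 < nth 0 (grid_values f) b.+1].

Definition mesh_occurrence f : bool :=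
  [&& increasing f, order_isomorphic f
    & [forall c in mesh_cells p, ~~ [exists r, in_cell f c.1 c.2 r]]].

Definition mesh_count : nat := #|[set f | mesh_occurrence f]|.

End Occurrences.

Definition cells_R : {set 'I_4 * 'I_4} :=
  [set c | (nat_of_ord c.1, nat_of_ord c.2) \in
    [:: (1, 0); (1, 1); (2, 0); (2, 1); (2, 2); (3, 0); (3, 1); (3, 2)]].

Definition perm123 : 'S_3 := 1%g.
Definition perm132 : 'S_3 := tperm (@Ordinal 3 1 isT) (@Ordinal 3 2 isT).

Lemma perm123_one_line : [seq (perm123 i).+1 | i <- enum 'I_3] = [:: 1; 2; 3].
Proof.
rewrite (eq_map (_ : _ =1 fun i : 'I_3 => i.+1)); last by move=> i; rewrite perm1.
by rewrite (map_comp S val) val_enum_ord.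
Qed.

Lemma perm132_one_line : [seq (perm132 i).+1 | i <- enum 'I_3] = [:: 1; 3; 2].
Proof.
pose g k := if k == 1 then 3 else if k == 2 then 2 else k.+1.
rewrite (eq_map (_ : _ =1 fun i : 'I_3 => g i)).
  by rewrite (map_comp g val) val_enum_ord.
by move=> i; rewrite permE /= -!val_eqE /g /=; case: ifP => // _; case: ifP.
Qed.

Definition P13 : mesh_pattern 3 := MeshPattern perm123 cells_R.
Definition P14 : mesh_pattern 3 := MeshPattern perm132 cells_R.

(* Main.v *)
Require Import Defs.
From mathcomp Require Import all_boot all_fingroup.
From mathcomp Require Import zify.

Set Implicit Arguments.
Unset Strict Implicit.
Unset Printing Implicit Defensive.

(** The two statistics can be read off the Lehmer code
    c_j = #{k > j : s k < s j}.  In an occurrence at positions i < j < k of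
    either pattern, i and the lower of j, k are consecutive right-to-left
    minima, and s j, s k are the two smallest letters from position j on.
    Hence the middle position j determines i and k ([occurrence3_inj]), and
    j is the middle of an occurrence exactly when c vanishes somewhere before
    j, position j is not the last one, and c_j = 0 (for 123) or c_j = 1
    (for 132); see [mesh_count_stat].

    The code is a bijection from permutations onto the sequences c with
    c_j < n - j, positions starting at 0 ([codes_onto]).  Exchanging the values 0 and 1 at every
    non-final position that comes after the first zero keeps these bounds and
    does not move the first zero, so it is an involution of the codes
    ([swap01K]); it exchanges the two statistics ([stat_swap01]). *)

(** * The Lehmer code *)

Lemma card_below m n : m <= n -> #|[pred k : 'I_n | k < m]| = m.
Proof.
move=> mn; rewrite -sum1_card -[RHS](card_ord m) -sum1_card.
by rewrite (big_ord_widen n (fun=> 1) mn).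
Qed.

Section LehmerCode.

Variable n : nat.
Implicit Types (s t : 'S_n) (i j k r : 'I_n).

Definition lower_right s j : {set 'I_n} := [set k : 'I_n | (j < k) && (s k < s j)].

Definition code s : {ffun 'I_n -> 'I_n.+1} :=
  [ffun j => inord #|lower_right s j|].

Lemma lower_right_bound s j : #|lower_right s j| < n - j.
Proof.
have := cardsC [set k : 'I_n | k < j.+1].
rewrite cardsE card_below // card_ord => later.
have -> : n - j = #|~: [set k : 'I_n | k < j.+1]|.+1 by lia.
apply: subset_leq_card; apply/subsetP => k.
by rewrite !inE -ltnNge => /andP[].
Qed.

Lemma code_val s j : code s j = #|lower_right s j| :> nat.
Proof. by rewrite ffunE inordK //; have := lower_right_bound s j; lia. Qed.

Lemma code_eq0P s i :
  reflect (forall r, i < r -> s i < s r) (code s i == 0 :> nat).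
Proof.
rewrite code_val cards_eq0; apply: (iffP eqP) => [E r ir | H].
  rewrite ltnNge leq_eqVlt; apply/negP => /orP[/eqP/val_inj/perm_inj E1|sr].
    by rewrite E1 ltnn in ir.
  by have := in_set0 r; rewrite -E inE ir sr.
apply/setP => r; rewrite !inE; apply/negP => /andP[/H]; lia.
Qed.

Lemma code_inj : injective code.
Proof.
move=> s t E.
have Ec j : #|lower_right s j| = #|lower_right t j| by rewrite -!code_val E.
apply/permP => j; have [m] := ubnP (nat_of_ord j).
elim: m j => // m IH j jm.
(* The letters from position j on are those not used before j, so they are the
   same for u and w; if u j is smaller than w j, then u j itself is an
   additional letter below w j to the right of j in w. *)
have key (u w : 'S_n) : (forall r, r < j -> u r = w r) -> u j < w j ->
    #|lower_right u j| < #|lower_right w j|.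
  move=> uw lt.
  rewrite -(card_imset (lower_right u j) (@perm_inj _ u)).
  rewrite -(card_imset (lower_right w j) (@perm_inj _ w)).
  have later r r' : u r = w r' -> (j <= r) -> (j <= r').
    move=> e jr; rewrite leqNgt; apply/negP => r'j.
    by move: e; rewrite -uw // => /perm_inj e; rewrite e in jr; lia.
  have wE v : exists r, v = w r by exists ((w^-1)%g v); rewrite permKV.
  apply: proper_card; apply/properP; split.
    apply/subsetP => _ /imsetP[r /[!inE]/andP[jr ur] ->].
    have [r' e] := wE (u r); rewrite e in ur *; apply: imset_f; rewrite inE.
    have := later _ _ e (ltnW jr); rewrite leq_eqVlt.
    by case/orP => [/eqP/val_inj e'|->]; [rewrite -e' in ur|]; lia.
  exists (u j).
    have [r' e] := wE (u j); rewrite e in lt *; apply: imset_f; rewrite inE lt.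
    have := later _ _ e (leqnn j); rewrite leq_eqVlt andbT.
    by case/orP => [/eqP/val_inj e'|//]; rewrite -e' ltnn in lt.
  by apply/imsetP => -[r + /perm_inj e]; rewrite -e inE ltnn.
have st r : r < j -> s r = t r by move=> rj; apply: IH; lia.
case: (ltngtP (s j) (t j)) => [lt|lt|/val_inj //].
  by have := key _ _ st lt; rewrite Ec ltnn.
by have := key _ _ (fun r rj => esym (st r rj)) lt; rewrite Ec ltnn.
Qed.

Definition codes : {pred {ffun 'I_n -> 'I_n.+1}} :=
  family (fun j => [pred v : 'I_n.+1 | v < n - j]).

Lemma card_codes : #|codes| = n`!.
Proof.
rewrite card_family foldrE big_image /=.
rewrite (eq_bigr (fun j : 'I_n => n - j)) => [|j _]; last first.
  by apply: card_below; lia.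
by rewrite -ffactnn ffact_prod.
Qed.

Lemma mem_codes s : code s \in codes.
Proof. by apply/familyP => j; rewrite inE code_val lower_right_bound. Qed.

(** The code is injective between two sets of size n!. *)
Lemma codes_onto c : c \in codes -> exists s, c = code s.
Proof.
have sub : codom code \subset codes.
  by apply/subsetP => _ /codomP[s ->]; apply: mem_codes.
have eq_card : #|codom code| = #|codes|.
  by rewrite card_codes card_codom ?card_Sn //; apply: code_inj.
by rewrite -(subset_cardP eq_card sub) => /codomP.
Qed.

End LehmerCode.

Arguments codes : clear implicits.

(** * Exchanging zeros and ones after the first zero *)

Section Swap.

Variable n : nat.
Implicit Types (c : {ffun 'I_n -> 'I_n.+1}) (i j : 'I_n) (v : nat).

Definition after_zero c j := [exists i : 'I_n, (i < j) && (c i == 0 :> nat)].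

Definition free_pos c j := (j.+1 < n) && after_zero c j.

Definition stat v c := #|[set j | free_pos c j & c j == v :> nat]|.

Definition swap01 c : {ffun 'I_n -> 'I_n.+1} :=
  [ffun j => if free_pos c j then tperm (inord 0) (inord 1) (c j) else c j].

(** The first zero is not after a zero, hence it is left in place, and every
    zero that the exchange creates lies after it. *)
Lemma after_zero_swap01 c j : after_zero (swap01 c) j = after_zero c j.
Proof.
apply/existsP/existsP => -[i /andP[ij ci0]].
  move: ci0; rewrite ffunE; case: ifP => [|_ ci0]; last first.
    by exists i; rewrite ij.
  case/andP => _ /existsP[i' /andP[i'i ci'0]] _.
  by exists i'; rewrite ci'0 (ltn_trans i'i ij).
case: (arg_minnP (P := fun i => c i == 0 :> nat) (@nat_of_ord n) ci0).
move=> i0 ci00 min_i0; have i0j := leq_ltn_trans (min_i0 _ ci0) ij.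
exists i0; rewrite i0j ffunE; case: ifP => //.
case/andP => _ /existsP[i' /andP[i'i /min_i0]].
by rewrite leqNgt i'i.
Qed.

Lemma free_pos_swap01 c j : free_pos (swap01 c) j = free_pos c j.
Proof. by rewrite /free_pos after_zero_swap01. Qed.

Lemma swap01K : involutive swap01.
Proof.
move=> c; apply/ffunP => j; rewrite ffunE free_pos_swap01 ffunE.
by case: ifP => free; rewrite free ?tpermK.
Qed.

Lemma swap01_codes c : c \in codes n -> swap01 c \in codes n.
Proof.
move=> /familyP cn; apply/familyP => j; have := cn j; rewrite !inE ffunE.
by case: ifP => // /andP[jn _]; case: tpermP => // _ _; rewrite inordK; lia.
Qed.

Lemma stat_swap01 c :
  (stat 0 (swap01 c) = stat 1 c) * (stat 1 (swap01 c) = stat 0 c).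
Proof.
suff E0 d : stat 0 (swap01 d) = stat 1 d by split=> //; rewrite -E0 swap01K.
apply: eq_card => j; rewrite !inE free_pos_swap01 ffunE.
case: ifP => // /andP[jn _] /=; have n_gt0 : 1 < n.+1 by lia.
have [v0 v1] : (inord 0 : 'I_n.+1) = 0 :> nat /\ (inord 1 : 'I_n.+1) = 1 :> nat.
  by rewrite !inordK.
case: tpermP => [->|->|]; rewrite ?v0 ?v1 // => /eqP + /eqP.
by rewrite -!val_eqE /= v0 v1 => /negPf-> /negPf->.
Qed.

End Swap.

Lemma card_stat_le n k l :
  #|[set s : 'S_n | (stat 0 (code s) == k) && (stat 1 (code s) == l)]| <=
  #|[set s : 'S_n | (stat 0 (code s) == l) && (stat 1 (code s) == k)]|.
Proof.
have inj : injective (@swap01 n \o @code n).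
  exact: inj_comp (can_inj (@swap01K n)) (@code_inj n).
rewrite -(card_imset _ inj) -[leqRHS](card_imset _ (@code_inj n)).
apply/subset_leq_card/subsetP => _ /imsetP[s /[!inE]/andP[s0 s1] ->] /=.
have [t e] := codes_onto (swap01_codes (mem_codes s)).
by rewrite e imset_f // inE -e !stat_swap01 s0 s1.
Qed.

(** * Occurrences of the two patterns *)

(** The common form of both patterns: the first letter is below the other two,
    and the shaded cells force everything between i and j to lie above the
    second smallest letter, and everything to the right of j other than k to
    lie above the largest one. *)
Definition occurrence3 n (s : 'S_n) (i j k : 'I_n) : Prop :=
  [/\ i < j, j < k, s i < minn (s j) (s k),
      forall r : 'I_n, i < r -> r < j -> minn (s j) (s k) < s r
    & forall r : 'I_n, j < r -> r != k -> maxn (s j) (s k) < s r].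

Lemma occurrence3_inj n (s : 'S_n) i i' j k k' :
  occurrence3 s i j k -> occurrence3 s i' j k' -> i = i' /\ k = k'.
Proof.
move=> [ij jk si Hl Hr] [i'j jk' si' Hl' Hr'].
have ek : k = k'.
  apply/eqP/contraT => ne.
  have := Hr' _ jk ne; rewrite eq_sym in ne; have := Hr _ jk' ne; lia.
split=> //; rewrite -ek in si' Hl'; apply: val_inj => /=.
case: (ltngtP i i') => // lt.
  by have := Hl _ lt i'j; lia.
by have := Hl' _ lt ij; lia.
Qed.

Lemma ord3P (P : 'I_3 -> Prop) :
  P (inord 0) -> P (inord 1) -> P (inord 2) -> forall a, P a.
Proof.
move=> P0 P1 P2 a; rewrite -(inord_val a).
by case: a => -[|[|[|]]].
Qed.

Lemma enum_ord3 : enum 'I_3 = [:: inord 0; inord 1; inord 2].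
Proof.
apply: (inj_map val_inj); rewrite val_enum_ord /=.
by rewrite !inordK.
Qed.

Lemma sort3 x y z : x < minn y z ->
  sort leq [:: x; y; z] = [:: x; minn y z; maxn y z].
Proof.
move=> lt; apply: (sorted_eq leq_trans anti_leq).
- exact: sort_sorted leq_total _.
- by rewrite /=; lia.
rewrite perm_sort perm_cons.
by case: (leqP y z) => _ //; apply/permPl/(perm_catC [:: y] [:: z]).
Qed.

Lemma mem_cells_RP (P : nat -> nat -> bool) :
  reflect (forall a b, (a, b) \in
      [:: (1, 0); (1, 1); (2, 0); (2, 1); (2, 2); (3, 0); (3, 1); (3, 2)] ->
      P a b)
    [forall c in cells_R, P c.1 c.2].
Proof.
apply: (iffP forall_inP) => [H a b ab | H [a b]]; last by rewrite inE; apply: H.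
have [a4 b4] : a < 4 /\ b < 4.
  by move: ab; rewrite !inE !xpair_eqE; lia.
by have := H (inord a, inord b); rewrite inE /= !inordK //; apply.
Qed.

(** The cells in column 1 leave only rows 2 and 3 to the letters between i and
    j; those in columns 2 and 3 leave only row 3 to the letters after j.  The
    hypothesis puts the lowest letter first, as in 123 and 132. *)
Lemma mesh_occurrenceP n (s : 'S_n) (w : 'S_3) (f : {ffun 'I_3 -> 'I_n}) :
  w (inord 0) = 0 :> nat ->
  reflect (occurrence3 s (f (inord 0)) (f (inord 1)) (f (inord 2)) /\
           (s (f (inord 1)) < s (f (inord 2))) = (w (inord 1) < w (inord 2)))
    (mesh_occurrence (MeshPattern w cells_R) s f).
Proof.
move=> w0.
have neq m (t : 'S_m) x y : (t x == t y :> nat) = (x == y :> nat).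
  by rewrite !val_eqE (inj_eq perm_inj).
have w01 := neq _ w (inord 0) (inord 1); have w02 := neq _ w (inord 0) (inord 2).
have w12 := neq _ w (inord 1) (inord 2).
rewrite !inordK // in w01 w02 w12.
have s12 := neq _ s (f (inord 1)) (f (inord 2)).
have sr r a := neq _ s r (f a).
pose i := f (inord 0); pose j := f (inord 1); pose k := f (inord 2).
have gridE : s i < minn (s j) (s k) ->
    grid_indices f = [:: 0; i.+1; j.+1; k.+1; n.+1] /\
    grid_values s f =
      [:: 0; (s i).+1; (minn (s j) (s k)).+1; (maxn (s j) (s k)).+1; n.+1].
  move=> lt; rewrite /grid_indices /grid_values enum_ord3 /= sort3 -/i -/j -/k.
    by rewrite minnSS maxnSS.
  by lia.
apply: (iffP and3P) => [[/forallP inc /forallP iso cells] | [[ij jk si Hl Hr] ejk]].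
  have /forallP inc0 := inc (inord 0); have /forallP inc1 := inc (inord 1).
  have := inc0 (inord 1); have := inc1 (inord 2); rewrite !inordK //= -/i -/j -/k.
  move=> jk ij.
  have /forallP iso0 := iso (inord 0); have /forallP iso1 := iso (inord 1).
  have /eqP := iso0 (inord 1); have /eqP := iso0 (inord 2).
  have /eqP := iso1 (inord 2); rewrite /= w0 -/i -/j -/k => ejk eik eij.
  have si : s i < minn (s j) (s k) by lia.
  have [gi gv] := gridE si.
  move/(mem_cells_RP (fun a b => ~~ [exists r, in_cell s f a b r])): cells => cells.
  have cell a b r (ab : (a, b) \in _) := negbTE (existsPn (cells a b ab) r).
  rewrite /in_cell gi gv in cell.
  have [sri srj srk] := And3 (sr^~ (inord 0)) (sr^~ (inord 1)) (sr^~ (inord 2)).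
  rewrite -/i -/j -/k in sri srj srk.
  split=> //; split=> // r.
    move=> ir rj; have := cell 1 0 r isT; have := cell 1 1 r isT.
    have := sri r; have := srj r; have := srk r.
    rewrite /= !ltnS ir rj /=; move: ir rj jk si; clear; lia.
  move=> jr; rewrite -val_eqE neq_ltn /= => /orP[rk|kr].
    have := cell 2 0 r isT; have := cell 2 1 r isT; have := cell 2 2 r isT.
    have := sri r; have := srj r; have := srk r.
    rewrite /= !ltnS jr rk /=; move: jr rk ij si; clear; lia.
  have := cell 3 0 r isT; have := cell 3 1 r isT; have := cell 3 2 r isT.
  have := sri r; have := srj r; have := srk r.
  rewrite /= !ltnS kr ltn_ord /=; move: kr jk ij si; clear; lia.
rewrite -/i -/j -/k in ij jk si Hl Hr ejk s12.
split.
- by apply/forallP; elim/ord3P; apply/forallP; elim/ord3P; rewrite !inordK //=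
     -/i -/j -/k; lia.
- by apply/forallP; elim/ord3P; apply/forallP; elim/ord3P; rewrite /= -/i -/j -/k;
     lia.
have [gi gv] := gridE si.
apply/(mem_cells_RP (fun a b => ~~ [exists r, in_cell s f a b r])) => a b ab.
apply/existsPn => r; rewrite /in_cell gi gv.
have Hl' := Hl r; have := Hr r; rewrite -val_eqE /= => Hr'.
by move: ab; rewrite !inE !xpair_eqE; do 7? [case/orP];
  case/andP => /eqP-> /eqP-> /=; rewrite !ltnS;
  move: Hl' Hr' ij jk si; clear; lia.
Qed.

(** A letter i is a right-to-left minimum exactly when its code is 0, and the
    code of j counts the letters on its right that are smaller: none if
    s j < s k, only k otherwise. *)
Lemma occurrence3_middle n (s : 'S_n) (j : 'I_n) (b : bool) :
  (exists i k, occurrence3 s i j k /\ (s j < s k) = b) <->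
  free_pos (code s) j /\ code s j = ~~ b :> nat.
Proof.
split=> [[i [k [[ij jk si Hl Hr] ejk]]] | [/andP[jn /existsP[i0 /andP[i0j]]]]].
  have Hr' (r : 'I_n) : j < r -> r = k \/ maxn (s j) (s k) < s r.
    by move=> jr; case: (eqVneq r k) => [|/(Hr _ jr)]; [left | right].
  split.
    rewrite /free_pos (leq_trans _ (ltn_ord k)) //=; apply/existsP; exists i.
    rewrite ij; apply/code_eq0P => r ir; case: (ltngtP r j) => [rj|jr|].
    - by have := Hl _ ir rj; lia.
    - by case: (Hr' _ jr) => [->|]; lia.
    - by move/val_inj=> ->; lia.
  rewrite code_val; transitivity #|[set r in [set k] | ~~ b]|; last first.
    case: b ejk => _; first by rewrite eq_card0 // => r; rewrite !inE andbF.
    by rewrite -[RHS](cards1 k); apply: eq_card => r; rewrite !inE andbT.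
  apply: eq_card => r; rewrite !inE; apply/andP/andP => -[].
    by move=> /Hr'[-> | lt]; rewrite ?eqxx; [split=> //; lia | lia].
  move=> /eqP-> bF; split=> //; move: ejk bF => <-; rewrite -leqNgt leq_eqVlt.
  by case/orP => // /eqP/val_inj/perm_inj e; rewrite e ltnn in jk.
move=> /code_eq0P Hi0 codej.
have [k [jk ejk Hr]] : exists k : 'I_n, [/\ j < k, (s j < s k) = b
    & forall r : 'I_n, j < r -> r != k -> maxn (s j) (s k) < s r].
  case: b codej => /= [/eqP/code_eq0P Hj | ].
    (* k is the position of the smallest letter to the right of j *)
    case: (arg_minnP (P := fun r : 'I_n => j < r) (fun r => s r : nat)
             (ltnSn j : j < Ordinal jn)) => k jk min_k.
    exists k; split=> // [|r jr]; first by rewrite Hj.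
    rewrite -(inj_eq (@perm_inj _ s)) -val_eqE /=.
    by have := Hj _ jr; have := min_k _ jr; lia.
  rewrite code_val => /eqP/cards1P[k Dk].
  have := set11 k; rewrite -Dk inE => /andP[jk skj].
  exists k; split=> // [|r jr rk]; first by lia.
  have := in_set1 r k; rewrite -Dk (negPf rk) inE jr /=.
  have : s r != s j by rewrite (inj_eq perm_inj) -val_eqE /=; lia.
  by rewrite -val_eqE /=; lia.
(* i is the last position before j with a letter below both s j and s k *)
pose P (r : 'I_n) := (r < j) && (s r < minn (s j) (s k)).
have Pi0 : P i0.
  by rewrite /P i0j leq_min Hi0 // Hi0 // (ltn_trans i0j jk).
case: (arg_maxnP (P := P) (@nat_of_ord n) Pi0) => i /andP[ij si] max_i.
exists i, k; split=> //; split=> // r ir rj.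
have srj : s r != s j by rewrite (inj_eq perm_inj) -val_eqE /=; lia.
have srk : s r != s k by rewrite (inj_eq perm_inj) -val_eqE /=; lia.
have := max_i r; rewrite /P rj /=; rewrite -!val_eqE /= in srj srk; lia.
Qed.

Lemma mesh_count_stat n (s : 'S_n) (w : 'S_3) :
  w (inord 0) = 0 :> nat ->
  mesh_count (MeshPattern w cells_R) s =
  stat (~~ (w (inord 1) < w (inord 2))) (code s).
Proof.
move=> w0; set b := _ < _.
pose mid (f : {ffun 'I_3 -> 'I_n}) := f (inord 1).
rewrite /mesh_count -(card_in_imset (f := mid)) => [|f g]; last first.
  rewrite !inE => /(mesh_occurrenceP _ _ w0)[occf _] /(mesh_occurrenceP _ _ w0)[occg _].
  rewrite /mid => e1; rewrite e1 in occf; have [e0 e2] := occurrence3_inj occf occg.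
  by apply/ffunP; elim/ord3P.
apply: eq_card => j; rewrite [RHS]inE.
apply/imsetP/andP => [[f] | H].
  rewrite inE => /(mesh_occurrenceP _ _ w0)[occ eb] ->.
  have [|fr c] := (occurrence3_middle s (mid f) b).1; last by rewrite fr c.
  by exists (f (inord 0)), (f (inord 2)).
have [|i [k [oc eb]]] := (occurrence3_middle s j b).2.
  by case: H => -> /eqP.
exists [ffun a : 'I_3 => nth j [:: i; j; k] a]; last by rewrite /mid ffunE inordK.
by rewrite inE; apply/(mesh_occurrenceP _ _ w0); rewrite !ffunE !inordK.
Qed.

Lemma mesh_count_P13 n (s : 'S_n) : mesh_count P13 s = stat 0 (code s).
Proof. by rewrite mesh_count_stat /perm123 !perm1 !inordK. Qed.

Lemma mesh_count_P14 n (s : 'S_n) : mesh_count P14 s = stat 1 (code s).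
Proof.
have e1 : inord 1 = Ordinal (isT : 1 < 3) by apply: val_inj; rewrite /= inordK.
have e2 : inord 2 = Ordinal (isT : 2 < 3) by apply: val_inj; rewrite /= inordK.
rewrite mesh_count_stat ?e1 ?e2 /perm132 ?tpermL ?tpermR //.
by rewrite tpermD -?val_eqE /= ?inordK.
Qed.

Theorem mainTheorem7 (n k l : nat) (hn : 1 <= n) :
  #|[set s : 'S_n | (mesh_count P13 s == k) && (mesh_count P14 s == l)]| =
  #|[set s : 'S_n | (mesh_count P14 s == k) && (mesh_count P13 s == l)]|.
Proof.
have stats13 a b :
    #|[set s : 'S_n | (mesh_count P13 s == a) && (mesh_count P14 s == b)]| =
    #|[set s : 'S_n | (stat 0 (code s) == a) && (stat 1 (code s) == b)]|.
  by apply: eq_card => s; rewrite !inE mesh_count_P13 mesh_count_P14.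
transitivity #|[set s : 'S_n | (mesh_count P13 s == l) && (mesh_count P14 s == k)]|.
  by rewrite !stats13; apply/eqP; rewrite eqn_leq !card_stat_le.
by apply: eq_card => s; rewrite !inE andbC.
Qed.
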